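(* Under the standing assumptions below, for every $x\in\mathcal X$, $s\in\mathcal S$, $\gamma\in\mathbb R^I_+$, the function $\tilde D$ satisfies $$\tilde D(\gamma,x,s)=\sup_{a\in\tilde{\mathcal A}(x,s)}\ \inf_{\lambda\in\mathbb R^I_+}\Big[r(x,a,s)+\sum_{i=1}^I\big(\gamma^ig^i(x,a,s)+\lambda^i(g^i(x,a,s)-\bar g^i)\big)+\beta\,\mathbb E_s\tilde D(\gamma+\lambda,x',s')\Big],\quad x'=\zeta(x,a,s).$$
   Context: Setup. Let $\mathcal S$ be a finite set and $(s_t)_{t\ge0}$ a Markov chain on $\mathcal S$ with transition probabilities $\pi(s'|s)>0$ for all $s,s'\in\mathcal S$; for a shock history $s^t=(s_0,\dots,s_t)\in\mathcal S^{t+1}$ write $\pi^t(s^t|s_0)$ for its probability given $s_0$, and $\mathbb E_{s_t}$ (equivalently $\mathbb E_{s^t}$) for expectation over future shocks conditional on the history $s^t$. Let $\mathcal A\subset\mathbb R^n$ be a finite set, $\mathcal X\subseteq\mathbb R^m$ a countable set, $\zeta:\mathcal X\times\mathcal A\times\mathcal S\to\mathcal X$, $p:\mathcal X\times\mathcal A\times\mathcal S\to\mathbb R$, $r,g^1,\dots,g^I:\mathcal X\times\mathcal A\times\mathcal S\to\mathbb R$ bounded functions, $\bar g^1,\dots,\bar g^I\in\mathbb R$ constants and $\beta\in(0,1)$. A plan is a family $a=(a(s^t))_{t\ge0,\,s^t\in\mathcal S^{t+1}}$ with $a(s^t)\in\mathcal A$; given $x_0\in\mathcal X$ it induces states $x(s^0)=x_0$,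 $x(s^{t+1})=\zeta(x(s^t),a(s^t),s_t)$. Let $\tilde{\mathcal A}(x,s)=\{a\in\mathcal A:p(x,a,s)\ge0\}$ and let $\tilde{\mathcal A}^\infty(x_0)$ be the set of plans with $a(s^t)\in\tilde{\mathcal A}(x(s^t),s_t)$ for all $t,s^t$. A plan is feasible for $(x_0,s_0)$ if it lies in $\tilde{\mathcal A}^\infty(x_0)$ and satisfies the forward-looking constraints $\mathbb E_{s_t}\sum_{n=0}^\infty\beta^ng^i(x(s^{t+n}),a(s^{t+n}),s_{t+n})\ge\bar g^i$ for all $t$, $s^t$, $i$. Standing assumption: for every $x_0\in\mathcal X$, $s_0\in\mathcal S$ a feasible plan exists. Post-action histories: $\tilde{\mathcal H}^t=\mathcal S^{t+1}\times\mathcal A^{t+1}$ with elements $\tilde h^t=(s_0,a_0,\dots,s_t,a_t)$; along $s^t$ a plan generates $\tilde h^t=(s_0,a(s^0),\dots,s_t,a(s^t))$. $\tilde\Lambda$ is the set of families $(\lambda^i(\tilde h^t))_{t,\tilde h^t\in\tilde{\mathcal H}^t,i}$ with $\lambda^i(\tilde h^t)\ge0$ and $\sum_t\sum_{\tilde h^t}\sum_i\beta^t\lambda^i(\tilde h^t)\pi^t(s^t|s_0)<\infty$. For $\gamma\in\mathbb R^I_+$, $\tilde L(a,\lambda;\gamma,x_0,s_0)=\mathbb E_{s_0}\sum_{t\ge0}\beta^t\Big[r(x(s^t),a(s^t),s_t)+\sum_i\gamma^ig^i(x(s^t),a(s^t),s_t)+\sum_i\lambda^i(\tilde h^t)\Big(\sum_{n\ge0}\beta^ng^i(x(s^{t+n}),a(s^{t+n}),s_{t+n})-\bar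 g^i\Big)\Big]$ with $\tilde h^t$ generated by the plan, and $\tilde D(\gamma,x_0,s_0)=\inf_{\lambda\in\tilde\Lambda}\sup_{a\in\tilde{\mathcal A}^\infty(x_0)}\tilde L(a,\lambda;\gamma,x_0,s_0)$. *)

(* Defs.v *)
From mathcomp Require Import all_boot all_order all_algebra.
From mathcomp Require Import all_classical all_reals all_analysis.
Set Implicit Arguments. Unset Strict Implicit. Unset Printing Implicit Defensive.
Import Order.TTheory GRing.Theory Num.Theory numFieldNormedType.Exports.
Local Open Scope classical_set_scope.
Local Open Scope ring_scope.

(* Shock histories s^t = (s_0,...,s_t) are represented as [:: s_0; ...; s_t]
   (nonempty seq S, chronological order).  A plan is a function
   a : seq S -> A (only its values on nonempty histories matter). *)

(* pi s s' = pi(s'|s).  hprob pi h = pi^t(h | head h) = prod of consecutive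
   transition probabilities along h. *)
Fixpoint hprob (S : Type) (R : pzRingType) (pi : S -> S -> R) (h : seq S) : R :=
  match h with
  | s :: ((s' :: _) as h') => pi s s' * hprob pi h'
  | _ => 1
  end.

(* conditional probability of the continuation w given the history h:
   pi(s_{t+1},...,s_{t+n} | s_t) *)
Definition condp (S : Type) (R : pzRingType) (pi : S -> S -> R) (h w : seq S) : R :=
  hprob pi (drop (size h).-1 h ++ w).

(* induced state x(s^t): x(s^0)=x0, x(s^{k+1}) = zeta(x(s^k), a(s^k), s_k) *)
Fixpoint st_aux (S X A : Type) (zeta : X -> A -> S -> X) (a : seq S -> A)
    (x : X) (past fut : seq S) : X :=
  match fut with
  | [::] => x
  | s :: fut' => st_aux zeta a (zeta x (a (rcons past s)) s) (rcons past s) fut'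
  end.

Definition state (S X A : Type) (zeta : X -> A -> S -> X) (a : seq S -> A)
    (x0 : X) (h : seq S) : X :=
  st_aux zeta a x0 [::] (take (size h).-1 h).

Definition evalh (S X A : Type) (R : pzRingType) (zeta : X -> A -> S -> X)
    (f : X -> A -> S -> R) (a : seq S -> A) (x0 : X) (h : seq S) : R :=
  match h with
  | [::] => 0
  | s0 :: w => f (state zeta a x0 h) (a h) (last s0 w)
  end.

Definition posth (S A : Type) (a : seq S -> A) (h : seq S) : seq (S * A) :=
  zip h [seq a (take k.+1 h) | k <- iota 0 (size h)].

Definition rseries (R : realType) (u : nat -> R) : R := limn (series u).

Definition contval (R : realType) (S : finType) (X A : Type)
    (pi : S -> S -> R) (beta : R) (zeta : X -> A -> S -> X)
    (f : X -> A -> S -> R) (a : seq S -> A) (x0 : X) (h : seq S) : R :=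
  rseries (fun n => beta ^+ n *
     \sum_(w : n.-tuple S) condp pi h w * evalh zeta f a x0 (h ++ w)).

Definition Atil (R : realType) (S X A : Type) (p : X -> A -> S -> R)
    (x : X) (s : S) : set A := [set a | 0 <= p x a s].

Definition Ainf (R : realType) (S X A : Type) (zeta : X -> A -> S -> X)
    (p : X -> A -> S -> R) (x0 : X) : set (seq S -> A) :=
  [set a | forall (s : S) (w : seq S),
     a (s :: w) \in Atil p (state zeta a x0 (s :: w)) (last s w)].

Definition feasible (R : realType) (S : finType) (X A : Type) (nI : nat)
    (pi : S -> S -> R) (beta : R) (zeta : X -> A -> S -> X)
    (p : X -> A -> S -> R) (g : 'I_nI -> X -> A -> S -> R) (gbar : 'I_nI -> R)
    (x0 : X) (s0 : S) (a : seq S -> A) : Prop :=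
  Ainf zeta p x0 a /\
  forall (w : seq S) (i : 'I_nI),
    gbar i <= contval pi beta zeta (g i) a x0 (s0 :: w).

(* tilde Lambda (for initial shock s0): nonnegative multipliers on
   post-action histories with
   sum_t sum_{h~^t} sum_i beta^t lambda^i(h~^t) pi^t(s^t|s0) < oo.
   Post-action histories at date t are (s0,a0) :: w, w a t-tuple of (S*A)
   (histories not starting at s0 have probability 0 given s0). *)
Definition Lam (R : realType) (S A : finType) (nI : nat)
    (pi : S -> S -> R) (beta : R) (s0 : S) : set (seq (S * A) -> 'I_nI -> R) :=
  [set lam | (forall h i, 0 <= lam h i) /\
     (\sum_(0 <= t <oo) ((beta ^+ t *
        \sum_(a0 : A) \sum_(w : t.-tuple (S * A)) \sum_(i < nI)
          lam ((s0, a0) :: tval w) i * hprob pi (s0 :: map fst w))%:E) < +oo)%E].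

Definition Lag (R : realType) (S A : finType) (X : Type) (nI : nat)
    (pi : S -> S -> R) (beta : R) (zeta : X -> A -> S -> X)
    (r : X -> A -> S -> R) (g : 'I_nI -> X -> A -> S -> R) (gbar : 'I_nI -> R)
    (a : seq S -> A) (lam : seq (S * A) -> 'I_nI -> R) (gam : 'I_nI -> R)
    (x0 : X) (s0 : S) : R :=
  rseries (fun t => beta ^+ t *
     \sum_(w : t.-tuple S) hprob pi (s0 :: w) *
       (evalh zeta r a x0 (s0 :: w)
        + \sum_(i < nI) gam i * evalh zeta (g i) a x0 (s0 :: w)
        + \sum_(i < nI) lam (posth a (s0 :: w)) i *
             (contval pi beta zeta (g i) a x0 (s0 :: w) - gbar i))).

Definition Dtil (R : realType) (S A : finType) (X : Type) (nI : nat)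
    (pi : S -> S -> R) (beta : R) (zeta : X -> A -> S -> X)
    (p r : X -> A -> S -> R) (g : 'I_nI -> X -> A -> S -> R) (gbar : 'I_nI -> R)
    (gam : 'I_nI -> R) (x0 : X) (s0 : S) : \bar R :=
  ereal_inf [set ereal_sup [set (Lag pi beta zeta r g gbar a lam gam x0 s0)%:E
                           | a in Ainf zeta p x0]
            | lam in @Lam R S A nI pi beta s0].

(* Main.v *)
Require Import Defs.
From mathcomp Require Import all_boot all_order all_algebra.
From mathcomp Require Import all_classical all_reals all_analysis.
Import Order.TTheory GRing.Theory Num.Theory.
Import numFieldNormedType.Exports.
Local Open Scope classical_set_scope.
Local Open Scope ring_scope.
Set Implicit Arguments. Unset Strict Implicit. Unset Printing Implicit Defensive.

(** Splitting off the date-0 terms shows that the Lagrangian of a plan [a] and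
   multipliers [lam] is the date-0 payoff plus the discounted mean, over the next
   shock [s1], of the Lagrangian of the continuation plan and continuation
   multipliers, with weight [gam] raised by the date-0 multiplier.  Continuation
   plans can be chosen separately for each [s1], and, because multipliers may
   depend on past actions, continuation multipliers can be chosen separately for
   each pair of a date-0 action and a shock [s1].  Hence the infimum over
   multipliers commutes with the finite supremum over the date-0 action, without
   any minimax theorem.  Feasible plans bound the dual value from below and the zero
   multiplier bounds it from above, so the continuation values are finite. *)

(** * Sums over tuples of fixed length *)

Lemma big_tuple_cons (V : nmodType) (T : finType) (n : nat)
    (F : seq T -> V) :
  \sum_(w : n.+1.-tuple T) F w = \sum_(s : T) \sum_(w : n.-tuple T) F (s :: w).
Proof.
rewrite pair_bigA /=.
rewrite (reindex (fun q : T * n.-tuple T => cons_tuple q.1 q.2)) //=.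
exists (fun w => (thead w, behead_tuple w)) => [[s w] _|w _].
  by congr pair; apply: val_inj.
by rewrite [RHS]tuple_eta; apply: val_inj.
Qed.

Lemma big_tuple0 (V : nmodType) (T : finType) (F : seq T -> V) :
  \sum_(w : 0.-tuple T) F w = F [::].
Proof.
rewrite (eq_bigr (fun=> F [::])); last by move=> w _; rewrite tuple0.
by rewrite sumr_const card_tuple expn0 mulr1n.
Qed.

(** * Discounted expected sums over shock histories *)

Section DiscountedExpectation.
Variables (R : realType) (S : finType) (pi : S -> S -> R) (beta : R).
Hypothesis pi_pos : forall s s', 0 < pi s s'.
Hypothesis pi_sum : forall s, \sum_(s' : S) pi s s' = 1.
Hypothesis beta_gt0 : 0 < beta.
Hypothesis beta_lt1 : beta < 1.

Definition expect_at (phi : seq S -> R) (s : S) (t : nat) : R :=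
  \sum_(w : t.-tuple S) hprob pi (s :: w) * phi (s :: w).

Definition dseries (phi : seq S -> R) (s : S) (t : nat) : R :=
  beta ^+ t * expect_at phi s t.

(** [dsum] carries no information when the series diverges, so convergence and value are recorded
    together. *)
Definition dcvg (phi : seq S -> R) (s : S) (l : R) : Prop :=
  series (dseries phi s) @ \oo --> l.

Definition dsum (phi : seq S -> R) (s : S) : R := rseries (dseries phi s).

Lemma hprob_ge0 h : 0 <= hprob pi h.
Proof.
elim: h => //= s [|s' h] //= IH.
by rewrite mulr_ge0 ?(ltW (pi_pos _ _)).
Qed.

Lemma expect_at0 phi s : expect_at phi s 0 = phi [:: s].
Proof.
by rewrite /expect_at (big_tuple0 (fun w => hprob pi (s :: w) * phi (s :: w))) mul1r.
Qed.

Lemma expect_atS phi s t :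
  expect_at phi s t.+1 = \sum_s1 pi s s1 * expect_at (phi \o cons s) s1 t.
Proof.
rewrite /expect_at (big_tuple_cons _ (fun w => hprob pi (s :: w) * phi (s :: w))).
by apply: eq_bigr => s1 _; rewrite big_distrr; apply: eq_bigr => w _; rewrite /= mulrA.
Qed.

Lemma eq_expect_at phi psi s t : (forall w, phi (s :: w) = psi (s :: w)) ->
  expect_at phi s t = expect_at psi s t.
Proof. by move=> e; apply: eq_bigr => w _; rewrite e. Qed.

Lemma ler_expect_at phi psi s t : (forall w, phi (s :: w) <= psi (s :: w)) ->
  expect_at phi s t <= expect_at psi s t.
Proof. by move=> e; apply: ler_sum => w _; rewrite ler_wpM2l ?hprob_ge0. Qed.

Lemma expect_at_cst c s t : expect_at (fun=> c) s t = c.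
Proof.
elim: t s => [|t IH] s; first by rewrite expect_at0.
rewrite expect_atS (eq_bigr (fun s1 => pi s s1 * c)) => [|s1 _].
  by rewrite -mulr_suml pi_sum mul1r.
by rewrite -[in RHS](IH s1).
Qed.

Lemma norm_expect_at phi s t :
  `|expect_at phi s t| <= expect_at (fun h => `|phi h|) s t.
Proof.
apply: (le_trans (ler_norm_sum _ _ _)); apply: ler_sum => w _.
by rewrite normrM (ger0_norm (hprob_ge0 _)).
Qed.

Lemma dcvg_lim phi s l : dcvg phi s l -> dsum phi s = l.
Proof. exact: cvg_lim. Qed.

(** Absolute convergence by comparison with a summable bound on the discounted expected absolute
    values. *)
Lemma dcvg_norm (u : nat -> R) phi s : cvgn (series u) ->
  (forall t, beta ^+ t * expect_at (fun h => `|phi h|) s t <= u t) ->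
  dcvg phi s (dsum phi s).
Proof.
move=> cu le_u; apply: normed_cvg.
have b0 t : 0 <= beta ^+ t by rewrite exprn_ge0 // ltW.
have le1 t : `|dseries phi s t| <= u t.
  apply: le_trans (le_u t).
  by rewrite /dseries normrM (ger0_norm (b0 t)) ler_wpM2l ?norm_expect_at.
apply: series_le_cvg cu => // t; first exact: normr_ge0.
exact: le_trans (normr_ge0 _) (le1 t).
Qed.

Lemma eq_dcvg phi psi s l : (forall w, phi (s :: w) = psi (s :: w)) ->
  dcvg phi s l -> dcvg psi s l.
Proof.
move=> e; rewrite /dcvg (_ : dseries phi s = dseries psi s) //.
by apply/funext => t; rewrite /dseries (eq_expect_at _ e).
Qed.

Lemma dcvgD phi psi s l m : dcvg phi s l -> dcvg psi s m ->
  dcvg (fun h => phi h + psi h) s (l + m).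
Proof.
move=> cl cm; rewrite /dcvg (_ : dseries _ s = dseries phi s + dseries psi s).
  by rewrite seriesD; apply: cvgD.
apply/funext => t; rewrite /dseries fctE -mulrDr /expect_at -big_split /=.
by congr (_ * _); apply: eq_bigr => w _; rewrite mulrDr.
Qed.

Lemma dcvgZ c phi s l : dcvg phi s l -> dcvg (fun h => c * phi h) s (c * l).
Proof.
move=> cl; rewrite /dcvg (_ : dseries _ s = c *: dseries phi s).
  by rewrite seriesZ; exact: cvgMl_tmp cl.
apply/funext => t; rewrite /dseries fctE /= /expect_at.
rewrite -[RHS]mulrCA (big_distrr c) /=.
by congr (_ * _); apply: eq_bigr => w _; rewrite mulrCA.
Qed.

Lemma dcvg_cst c s : dcvg (fun=> c) s (c / (1 - beta)).
Proof.
rewrite /dcvg (_ : dseries _ s = geometric c beta).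
  by apply: cvg_geometric_series; rewrite gtr0_norm.
by apply/funext => t; rewrite /dseries expect_at_cst mulrC.
Qed.

Lemma dcvg_sum n (c : 'I_n -> R) (phi : 'I_n -> seq S -> R) s (l : 'I_n -> R) :
  (forall i, dcvg (phi i) s (l i)) ->
  dcvg (fun h => \sum_i c i * phi i h) s (\sum_i c i * l i).
Proof.
move=> cl; elim: (index_enum _) => [|i r IH].
  rewrite big_nil -[X in dcvg _ _ X](mul0r (1 - beta)^-1); apply: eq_dcvg (@dcvg_cst 0 s) => w.
  by rewrite big_nil.
rewrite big_cons; apply: eq_dcvg (dcvgD (@dcvgZ (c i) _ _ _ (cl i)) IH) => w.
by rewrite big_cons.
Qed.

(** After its date-0 term the series from [s] is [beta] times the mean over [s1] of the series from
    [s1]; as [S] is finite, the limit passes through this mean. The one-step recursions below come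
    from here. *)
Lemma dcvg_rec phi s (l : S -> R) : (forall s1, dcvg (phi \o cons s) s1 (l s1)) ->
  dcvg phi s (phi [:: s] + beta * \sum_s1 pi s s1 * l s1).
Proof.
move=> cl; rewrite /dcvg -cvg_shiftS /=.
rewrite (_ : (fun n => _) = (fun n => phi [:: s] +
   beta * \sum_s1 pi s s1 * series (dseries (phi \o cons s) s1) n)).
  apply: cvgD; first exact: cvg_cst.
  apply: cvgMl_tmp; apply: cvg_big => [|s1 _]; first exact: add_continuous.
  apply: cvgMl_tmp; exact: cl.
apply/funext => n; rewrite seriesEnat /= big_nat_recl //.
rewrite {1}/dseries expect_at0 expr0 mul1r; congr (_ + _).
under [in RHS]eq_bigr do rewrite seriesEnat /= big_distrr.
rewrite exchange_big /= big_distrr /=; apply: eq_bigr => t _.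
rewrite /dseries expect_atS exprS -mulrA; congr (_ * _); rewrite big_distrr /=.
by apply: eq_bigr => s1 _; rewrite mulrCA.
Qed.

Lemma ler_dcvg phi psi s l m : (forall w, phi (s :: w) <= psi (s :: w)) ->
  dcvg phi s l -> dcvg psi s m -> l <= m.
Proof.
move=> e cl cm; rewrite -(dcvg_lim cl) -(dcvg_lim cm).
apply: lim_series_le; [exact: cvgP cl|exact: cvgP cm|move=> t].
by rewrite ler_wpM2l ?exprn_ge0 ?(ltW beta_gt0) // ler_expect_at.
Qed.

End DiscountedExpectation.

(** * Plans after the first shock, and their gluing *)

Section ShiftedPlans.
Variables (R : realType) (S : finType) (X A : Type) (pi : S -> S -> R) (beta : R).
Variable zeta : X -> A -> S -> X.

(** The accumulated past is only passed on to the plan, so its first shock can be absorbed into the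
    plan. *)
Lemma st_aux_cons (a : seq S -> A) x s past fut :
  st_aux zeta a x (s :: past) fut = st_aux zeta (a \o cons s) x past fut.
Proof. by elim: fut x past => //= s' fut IH x past; rewrite -IH. Qed.

Lemma state_cons (a : seq S -> A) x s s1 w :
  state zeta a x [:: s, s1 & w] =
  state zeta (a \o cons s) (zeta x (a [:: s]) s) (s1 :: w).
Proof. by rewrite /state /= st_aux_cons. Qed.

Lemma evalh_cons (f : X -> A -> S -> R) (a : seq S -> A) x s s1 w :
  evalh zeta f a x [:: s, s1 & w] =
  evalh zeta f (a \o cons s) (zeta x (a [:: s]) s) (s1 :: w).
Proof. by rewrite /evalh state_cons. Qed.

Lemma contval_cons (f : X -> A -> S -> R) (a : seq S -> A) x s s1 w :
  contval pi beta zeta f a x [:: s, s1 & w] =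
  contval pi beta zeta f (a \o cons s) (zeta x (a [:: s]) s) (s1 :: w).
Proof.
(* [condp] sees only the last shock of the history, so removing [s] in front leaves it unchanged by
   computation. *)
congr rseries; apply/funext => t; congr (_ * _); apply: eq_bigr => v _.
by rewrite -evalh_cons.
Qed.

Lemma posth_cons (a : seq S -> A) s w :
  posth a (s :: w) = (s, a [:: s]) :: posth (a \o cons s) w.
Proof.
rewrite /posth /= take0; congr (_ :: zip _ _).
by rewrite -[1%N]/(1 + 0)%N iotaDl -map_comp; apply: eq_map.
Qed.

Lemma eq_shifted_plan (a b : seq S -> A) s : (forall w, a (s :: w) = b (s :: w)) ->
  a \o cons s = b \o cons s.
Proof. by move=> e; apply/funext => w /=. Qed.

(** This and the next three lemmas serve gluing: a glued plan agrees with its pieces only on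
    histories that start with a given shock. *)
Lemma eq_evalh (f : X -> A -> S -> R) (a b : seq S -> A) x s w :
  (forall v, a (s :: v) = b (s :: v)) ->
  evalh zeta f a x (s :: w) = evalh zeta f b x (s :: w).
Proof.
move=> e; case: w => [|s1 w]; first by rewrite /= e.
by rewrite !evalh_cons (eq_shifted_plan e) e.
Qed.

Lemma eq_contval (f : X -> A -> S -> R) (a b : seq S -> A) x s w :
  (forall v, a (s :: v) = b (s :: v)) ->
  contval pi beta zeta f a x (s :: w) = contval pi beta zeta f b x (s :: w).
Proof.
move=> e; congr rseries; apply/funext => t; congr (_ * _); apply: eq_bigr => v _.
by rewrite (eq_evalh _ _ _ e).
Qed.

Lemma eq_state (a b : seq S -> A) x s w :
  (forall v, a (s :: v) = b (s :: v)) ->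
  state zeta a x (s :: w) = state zeta b x (s :: w).
Proof.
move=> e; case: w => [|s1 w] //.
by rewrite !state_cons (eq_shifted_plan e) e.
Qed.

Lemma eq_posth (a b : seq S -> A) s w : (forall v, a (s :: v) = b (s :: v)) ->
  posth a (s :: w) = posth b (s :: w).
Proof. by move=> e; rewrite !posth_cons (eq_shifted_plan e) e. Qed.

Lemma Ainf_cons (p : X -> A -> S -> R) (a : seq S -> A) x s :
  Ainf zeta p x a -> Ainf zeta p (zeta x (a [:: s]) s) (a \o cons s).
Proof. by move=> Ha s1 w; have := Ha s (s1 :: w); rewrite state_cons. Qed.

Lemma Ainf_head (p : X -> A -> S -> R) (a : seq S -> A) x s :
  Ainf zeta p x a -> Atil p x s (a [:: s]).
Proof. by move=> /(_ s [::]); rewrite in_setE. Qed.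

(* [d] is followed from initial shocks other than [s], since [Ainf] constrains
   plans at every initial shock. *)
Definition glue_plan (a0 : A) (s : S) (b : S -> seq S -> A) (d : seq S -> A)
    (h : seq S) : A :=
  if head s h == s then
    if behead h is s1 :: _ then b s1 (behead h) else a0
  else d h.

Lemma glue_planE a0 s b d s1 w :
  glue_plan a0 s b d [:: s, s1 & w] = b s1 (s1 :: w).
Proof. by rewrite /glue_plan /= eqxx. Qed.

Lemma glue_plan1 a0 s b d : glue_plan a0 s b d [:: s] = a0.
Proof. by rewrite /glue_plan /= eqxx. Qed.

Lemma Ainf_glue (p : X -> A -> S -> R) a0 s b d x :
  Atil p x s a0 -> (forall s1, Ainf zeta p (zeta x a0 s) (b s1)) ->
  Ainf zeta p x d -> Ainf zeta p x (glue_plan a0 s b d).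
Proof.
(* After an initial shock other than [s] the glued plan is [d]; after [s] it plays [a0] and then
   follows [b s1] from the state that [a0] leads to. *)
move=> Ha0 Hb Hd s' w; have [->|ne] := eqVneq s' s; last first.
  have e v : glue_plan a0 s b d (s' :: v) = d (s' :: v).
    by rewrite /glue_plan /= (negbTE ne).
  by rewrite (eq_state _ _ e) e; exact: Hd.
case: w => [|s1 w]; first by rewrite glue_plan1 in_setE.
rewrite state_cons glue_planE glue_plan1.
rewrite (@eq_state _ (b s1)) => [|v]; first exact: Hb.
by rewrite /= glue_planE.
Qed.

End ShiftedPlans.

(** * Bounded payoffs and their continuation values *)

Section ContinuationValues.
Variables (R : realType) (S : finType) (X A : Type) (pi : S -> S -> R) (beta : R).
Hypothesis pi_pos : forall s s', 0 < pi s s'.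
Hypothesis pi_sum : forall s, \sum_(s' : S) pi s s' = 1.
Hypothesis beta_gt0 : 0 < beta.
Hypothesis beta_lt1 : beta < 1.
Variable zeta : X -> A -> S -> X.
Variables (f : X -> A -> S -> R) (M : R).
Hypothesis f_bdd : forall x a s, `|f x a s| <= M.

Lemma evalh_bound (a : seq S -> A) x s w : `|evalh zeta f a x (s :: w)| <= M.
Proof. exact: f_bdd. Qed.

Lemma dcvg_evalh (a : seq S -> A) x s :
  dcvg pi beta (evalh zeta f a x) s (contval pi beta zeta f a x [:: s]).
Proof.
(* Payoffs bounded by [M] give the majorant $M\beta^t$ at date $t$. *)
apply: (@dcvg_norm _ _ _ _ pi_pos beta_gt0 (geometric M beta)).
  by apply: is_cvg_geometric_series; rewrite gtr0_norm.
move=> t; rewrite /= [leRHS]mulrC ler_wpM2l ?exprn_ge0 ?(ltW beta_gt0) //.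
rewrite -[leRHS](expect_at_cst pi_sum M s t).
by apply: (ler_expect_at pi_pos) => w; exact: evalh_bound.
Qed.

Lemma contval_rec (a : seq S -> A) x s :
  contval pi beta zeta f a x [:: s] = f x (a [:: s]) s + beta * \sum_s1 pi s s1 *
    contval pi beta zeta f (a \o cons s) (zeta x (a [:: s]) s) [:: s1].
Proof.
apply: (@dcvg_lim _ _ pi beta (evalh zeta f a x) s).
apply: dcvg_rec => s1; apply: eq_dcvg (@dcvg_evalh _ _ _) => w.
exact/esym/evalh_cons.
Qed.

(** Shifting the plan along the history reduces to date 0, where the payoffs are compared with the
    constants [- M] and [M]. *)
Lemma contval_bound (a : seq S -> A) x s w :
  `|contval pi beta zeta f a x (s :: w)| <= M / (1 - beta).
Proof.
elim: w a x s => [|s1 w IH] a x s; last by rewrite contval_cons.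
rewrite ler_norml -mulNr; apply/andP; split.
  apply: (ler_dcvg pi_pos beta_gt0 _ (@dcvg_cst _ _ _ _ pi_sum beta_gt0 beta_lt1 _ _) (@dcvg_evalh a x s)).
  by move=> w; have := evalh_bound a x s w; rewrite ler_norml => /andP[].
apply: (ler_dcvg pi_pos beta_gt0 _ (@dcvg_evalh a x s) (@dcvg_cst _ _ _ _ pi_sum beta_gt0 beta_lt1 _ _)).
by move=> w; have := evalh_bound a x s w; rewrite ler_norml => /andP[].
Qed.

End ContinuationValues.

(** * Multipliers and their mass on post-action histories *)

Section Multipliers.
Variables (R : realType) (S A : finType) (pi : S -> S -> R) (beta : R).
Hypothesis pi_pos : forall s s', 0 < pi s s'.
Hypothesis beta_gt0 : 0 < beta.

(** The undiscounted date-[t] term of the summability condition in [Lam], for a single weight [G].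
    It runs over all action sequences, not only those generated by one plan. *)
Definition path_mass (G : seq (S * A) -> R) (s : S) (t : nat) : R :=
  \sum_(a0 : A) \sum_(u : t.-tuple (S * A))
    G ((s, a0) :: u) * hprob pi (s :: map fst u).

Lemma path_massS G s t : path_mass G s t.+1 =
  \sum_a0 \sum_s1 pi s s1 * path_mass (G \o cons (s, a0)) s1 t.
Proof.
apply: eq_bigr => a0 _.
rewrite (big_tuple_cons _ (fun u => G ((s, a0) :: u) * hprob pi (s :: map fst u))).
under [RHS]eq_bigr do rewrite big_distrr /=.
rewrite [RHS]pair_bigA /=; apply: eq_bigr => -[s1 a1] _ /=.
by rewrite big_distrr /=; apply: eq_bigr => u _; rewrite mulrCA.
Qed.

Lemma path_mass_ge0 G s t : (forall h, 0 <= G h) -> 0 <= path_mass G s t.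
Proof.
move=> G0; apply: sumr_ge0 => a0 _; apply: sumr_ge0 => u _.
by rewrite mulr_ge0 ?hprob_ge0.
Qed.

(** The histories continuing [(s, a0)] with shock [s1] form one block of a sum of nonnegative
    terms. *)
Lemma ler_path_mass_cons G s a0 s1 t : (forall h, 0 <= G h) ->
  pi s s1 * path_mass (G \o cons (s, a0)) s1 t <= path_mass G s t.+1.
Proof.
move=> G0; rewrite path_massS (bigD1 a0) //= (bigD1 s1) //= -addrA lerDl.
have m0 a' s' : 0 <= pi s s' * path_mass (G \o cons (s, a')) s' t.
  by rewrite mulr_ge0 ?(ltW (pi_pos _ _)) // path_mass_ge0 // => h; exact: G0.
by rewrite addr_ge0 // sumr_ge0 // => a' _; rewrite sumr_ge0.
Qed.

(* Along the histories generated by a plan the post-action history determines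
   the shock history, so the left-hand side is a subsum of the right-hand side. *)
Lemma expect_at_posth_le G (a : seq S -> A) s t : (forall h, 0 <= G h) ->
  expect_at pi (G \o posth a) s t <= path_mass G s t.
Proof.
elim: t a s G => [|t IH] a s G G0.
  rewrite expect_at0 /path_mass (bigD1 (a [:: s])) //.
  rewrite (big_tuple0 (fun u => G ((s, a [:: s]) :: u) * hprob pi (s :: map fst u))).
  rewrite [X in _ <= X + _]/= mulr1 lerDl sumr_ge0 // => a0 _.
  by apply: sumr_ge0 => u _; rewrite mulr_ge0 ?hprob_ge0.
rewrite expect_atS path_massS (bigD1 (a [:: s])) //=.
have m0 a' s' : 0 <= pi s s' * path_mass (G \o cons (s, a')) s' t.
  by rewrite mulr_ge0 ?(ltW (pi_pos _ _)) // path_mass_ge0 // => h; exact: G0.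
apply: (@le_trans _ _ (\sum_s1 pi s s1 * path_mass (G \o cons (s, a [:: s])) s1 t)).
  apply: ler_sum => s1 _; rewrite ler_wpM2l ?(ltW (pi_pos _ _)) //.
  rewrite (@eq_expect_at _ _ _ _ ((G \o cons (s, a [:: s])) \o posth (a \o cons s))).
    by apply: IH => h; exact: G0.
  by move=> w; rewrite /= posth_cons.
by rewrite lerDl sumr_ge0 // => a' _; rewrite sumr_ge0.
Qed.

Variable nI : nat.

Definition total_mult (lam : seq (S * A) -> 'I_nI -> R) (h : seq (S * A)) : R :=
  \sum_(i < nI) lam h i.

Lemma total_mult_ge0 (lam : seq (S * A) -> 'I_nI -> R) h :
  (forall h i, 0 <= lam h i) -> 0 <= total_mult lam h.
Proof. by move=> l0; apply: sumr_ge0. Qed.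

(** The terms are nonnegative, so finiteness of the extended-real sum amounts to convergence of the
    real series, to which limit laws apply. *)
Lemma LamP s (lam : seq (S * A) -> 'I_nI -> R) : Lam pi beta s lam <->
  (forall h i, 0 <= lam h i) /\
  cvgn (series (fun t => beta ^+ t * path_mass (total_mult lam) s t)).
Proof.
have e t : beta ^+ t * (\sum_(a0 : A) \sum_(w : t.-tuple (S * A)) \sum_(i < nI)
      lam ((s, a0) :: tval w) i * hprob pi (s :: map fst w)) =
    beta ^+ t * path_mass (total_mult lam) s t.
  congr (_ * _); apply: eq_bigr => a0 _.
  by apply: eq_bigr => u _; rewrite /total_mult big_distrl.
rewrite /Lam /= (eq_eseriesr (fun t _ => congr1 EFin (e t))).
split=> -[l0 H]; split => //.
have u0 t : 0 <= beta ^+ t * path_mass (total_mult lam) s t.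
  rewrite mulr_ge0 ?exprn_ge0 ?(ltW beta_gt0) // path_mass_ge0 // => h.
  exact: total_mult_ge0.
  by apply: nnseries_is_cvg.
rewrite (_ : (\sum_(0 <= t <oo) _)%E =
  (limn (series (fun t => beta ^+ t * path_mass (total_mult lam) s t)))%:E) ?ltry //.
rewrite -EFin_lim //; congr (limn _); apply/funext => n.
by rewrite /= -sumEFin.
Qed.


End Multipliers.

(** * Restriction and gluing of multipliers *)

Lemma cvg_series_shift (R : realType) (u : nat -> R) :
  cvgn (series (u \o S)) <-> cvgn (series u).
Proof.
have e n : series u n.+1 = u 0%N + series (u \o S) n.
  by rewrite !seriesEnat /= big_nat_recl.
split=> [/cvg_ex[l cl]|/cvg_ex[l cl]]; apply/cvg_ex.
  exists (u 0%N + l); rewrite -cvg_shiftS /= (funext e).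
  by apply: cvgD cl; exact: cvg_cst.
exists (l - u 0%N).
rewrite (_ : series (u \o S) = (fun n => series u n.+1 - u 0%N)); last first.
  by apply/funext => n; rewrite e addrC addKr.
by apply: cvgB; [rewrite (cvg_shiftS (series u)) | exact: cvg_cst].
Qed.

Section MultiplierGluing.
Variables (R : realType) (S A : finType) (nI : nat) (pi : S -> S -> R) (beta : R).
Hypothesis pi_pos : forall s s', 0 < pi s s'.
Hypothesis beta_gt0 : 0 < beta.

Notation multiplier := (seq (S * A) -> 'I_nI -> R).

Lemma Lam0 s : Lam pi beta s (fun (_ : seq (S * A)) (_ : 'I_nI) => 0).
Proof.
apply/LamP => //; split => //.
rewrite (_ : series _ = fun=> 0); first exact: is_cvg_cst.
apply/funext => n; rewrite seriesEnat /= big1 // => t _.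
rewrite /path_mass big1 ?mulr0 // => a0 _.
by rewrite big1 // => u _; rewrite /total_mult big1 // mul0r.
Qed.

(** Since [pi] and [beta] are positive, the continuation carries at most $1/(\beta\,\pi(s_1|s))$
    times the discounted mass of [lam] after date 0. *)
Lemma Lam_cons s a0 s1 (lam : multiplier) :
  Lam pi beta s lam -> Lam pi beta s1 (lam \o cons (s, a0)).
Proof.
move=> /(LamP pi_pos beta_gt0)[l0 /(iffRL (cvg_series_shift _)) cl]; apply/LamP => //.
split=> [h i|]; first exact: l0.
have t0 h : 0 <= total_mult lam h by exact: total_mult_ge0.
have b0 t : 0 <= beta ^+ t by rewrite exprn_ge0 // ltW.
have c0 : 0 < beta * pi s s1 by rewrite mulr_gt0.
have cv := is_cvg_seriesZ (k := (beta * pi s s1)^-1) cl.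
apply: series_le_cvg cv => t.
- by rewrite mulr_ge0 // path_mass_ge0 // => h; exact: t0.
- by rewrite fctE /= /GRing.scale /= !mulr_ge0 ?invr_ge0 ?(ltW c0) // path_mass_ge0.
rewrite fctE /= /GRing.scale /= ler_pdivlMl // exprS mulrACA.
rewrite ler_wpM2l ?mulr_ge0 ?(ltW beta_gt0) //.
exact: (ler_path_mass_cons pi_pos).
Qed.

(** [mu] is indexed by the date-0 action as well as by the next shock, which is possible because
    multipliers observe actions. The value on the empty history is a nonnegative default. *)
Definition glue_multiplier (lam0 : A -> 'I_nI -> R) (mu : A -> S -> multiplier)
    (h : seq (S * A)) : 'I_nI -> R :=
  match h with
  | [::] => fun=> 0
  | [:: q] => lam0 q.2
  | q :: ((q1 :: _) as h') => mu q.2 q1.1 h'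
  end.

(** After date 0 the mass is [beta] times a finite combination of the masses of the [mu a s1], each
    of which is summable. *)
Lemma Lam_glue s lam0 (mu : A -> S -> multiplier) :
  (forall a i, 0 <= lam0 a i) -> (forall a s1, Lam pi beta s1 (mu a s1)) ->
  Lam pi beta s (glue_multiplier lam0 mu).
Proof.
move=> l0 Hmu; apply/LamP => //; split.
  move=> [|q [|q1 h]] i //=.
  by have /(LamP pi_pos beta_gt0)[] := Hmu q.2 q1.1.
apply/cvg_series_shift.
pose u a0 s1 t := beta ^+ t * path_mass pi (total_mult (mu a0 s1)) s1 t.
have cu a0 s1 : cvgn (series (u a0 s1)).
  by have /(LamP pi_pos beta_gt0)[] := Hmu a0 s1.
rewrite (_ : _ \o _ = (fun t => beta * \sum_a0 \sum_s1 pi s s1 * u a0 s1 t)).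
  rewrite (_ : series _ =
    (fun n => beta * \sum_a0 \sum_s1 pi s s1 * series (u a0 s1) n)).
    apply: is_cvgMl_tmp.
    apply/cvg_ex; exists (\sum_a0 \sum_s1 pi s s1 * limn (series (u a0 s1))).
    apply: cvg_big => [|a0 _]; first exact: add_continuous.
    apply: cvg_big => [|s1 _]; first exact: add_continuous.
    by apply: cvgMl_tmp; exact: cu.
  apply/funext => n; rewrite seriesEnat /= -big_distrr /=; congr (_ * _).
  rewrite exchange_big /=; apply: eq_bigr => a0 _.
  rewrite exchange_big /=; apply: eq_bigr => s1 _.
  by rewrite seriesEnat /= big_distrr.
apply/funext => t; rewrite /= path_massS exprS -mulrA; congr (_ * _).
rewrite big_distrr /=; apply: eq_bigr => a0 _.
rewrite big_distrr /=; apply: eq_bigr => s1 _.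
by rewrite mulrCA.
Qed.

End MultiplierGluing.

(** * The Lagrangian: convergence, one-step recursion and bounds *)

Section Lagrangian.
Variables (R : realType) (S A : finType) (X : Type) (nI : nat).
Variables (pi : S -> S -> R) (beta : R) (zeta : X -> A -> S -> X).
Variables (p r : X -> A -> S -> R) (g : 'I_nI -> X -> A -> S -> R).
Variables (gbar : 'I_nI -> R) (Mr : R) (Mg : 'I_nI -> R).
Hypothesis pi_pos : forall s s', 0 < pi s s'.
Hypothesis pi_sum : forall s, \sum_(s' : S) pi s s' = 1.
Hypothesis beta_gt0 : 0 < beta.
Hypothesis beta_lt1 : beta < 1.
Hypothesis r_bdd : forall x a s, `|r x a s| <= Mr.
Hypothesis g_bdd : forall i x a s, `|g i x a s| <= Mg i.

Notation multiplier := (seq (S * A) -> 'I_nI -> R).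
Notation cont i a x h := (contval pi beta zeta (g i) a x h).
Notation L a lam gam x s := (Lag pi beta zeta r g gbar a lam gam x s).

(** The stage term is split in two: this part is uniformly bounded, while [mult_stage] is only
    summable. *)
Definition base_stage (a : seq S -> A) (gam : 'I_nI -> R) x h : R :=
  evalh zeta r a x h + \sum_i gam i * evalh zeta (g i) a x h.

Definition mult_stage (a : seq S -> A) (lam : multiplier) x h : R :=
  \sum_i lam (posth a h) i * (cont i a x h - gbar i).

Lemma LagE a lam gam x s :
  L a lam gam x s = dsum pi beta (fun h => base_stage a gam x h + mult_stage a lam x h) s.
Proof. by []. Qed.


(** Continuation values are uniformly bounded, so the stage terms are at most a constant times the
    multipliers met along the plan, whose discounted mass is finite by [Lam]. *)
Lemma dcvg_mult a lam x s : Lam pi beta s lam ->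
  dcvg pi beta (mult_stage a lam x) s (dsum pi beta (mult_stage a lam x) s).
Proof.
move=> /(LamP pi_pos beta_gt0)[l0 cl].
pose B i := Mg i / (1 - beta) + `|gbar i|.
have B_ge i x' a' s' w : `|cont i a' x' (s' :: w) - gbar i| <= B i.
  apply: le_trans (ler_normB _ _) _; rewrite lerD2r.
  exact: (contval_bound pi_pos pi_sum beta_gt0 beta_lt1 zeta (g_bdd i)).
have B0 i : 0 <= B i by exact: le_trans (normr_ge0 _) (B_ge i x a s [::]).
have sB0 : 0 <= \sum_i B i by exact: sumr_ge0.
have b0 t : 0 <= beta ^+ t by rewrite exprn_ge0 // ltW.
apply: (dcvg_norm pi_pos beta_gt0 (is_cvg_seriesZ (k := \sum_i B i) cl)) => t.
rewrite fctE /= /GRing.scale /= mulrCA ler_wpM2l //.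
apply: (@le_trans _ _ (expect_at pi (fun h => (\sum_i B i) * total_mult lam (posth a h)) s t)).
  apply: (ler_expect_at pi_pos) => w.
  apply: le_trans (ler_norm_sum _ _ _) _.
  rewrite /total_mult big_distrr /=; apply: ler_sum => i _.
  rewrite normrM (ger0_norm (l0 _ _)) mulrC ler_wpM2r //.
  apply: le_trans (B_ge _ _ _ _ _) _.
  by rewrite (bigD1 i) //= lerDl sumr_ge0.
rewrite (_ : expect_at _ _ s t = (\sum_i B i) * expect_at pi (total_mult lam \o posth a) s t).
  rewrite ler_wpM2l //; apply: (expect_at_posth_le pi_pos) => h.
  exact: total_mult_ge0.
by rewrite big_distrr; apply: eq_bigr => w _; rewrite mulrCA.
Qed.

Lemma dcvg_Lag a lam gam x s : Lam pi beta s lam ->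
  dcvg pi beta (fun h => base_stage a gam x h + mult_stage a lam x h) s
    (L a lam gam x s).
Proof.
move=> Hl; have cr := @dcvg_evalh _ _ _ _ _ _ pi_pos pi_sum beta_gt0 beta_lt1 zeta _ _ r_bdd a x s.
have cg i := @dcvg_evalh _ _ _ _ _ _ pi_pos pi_sum beta_gt0 beta_lt1 zeta _ _ (g_bdd i) a x s.
have c := dcvgD (dcvgD cr (@dcvg_sum _ _ _ _ pi_sum beta_gt0 beta_lt1 _ gam _ _ _ cg)) (@dcvg_mult a _ x _ Hl).
by rewrite LagE (dcvg_lim c).
Qed.

(** The date-0 multiplier weighs the whole discounted stream of [g]. Moving its later terms to their
    own dates turns the weight [gam] into [gam + lam0] there. *)
Lemma Lag_rec a lam gam x s : Lam pi beta s lam ->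
  let a0 := a [:: s] in
  let lam0 := lam [:: (s, a0)] in
  L a lam gam x s =
  r x a0 s + \sum_(i < nI) (gam i * g i x a0 s + lam0 i * (g i x a0 s - gbar i)) +
  beta * \sum_s1 pi s s1 *
    L (a \o cons s) (lam \o cons (s, a0)) (fun i => gam i + lam0 i) (zeta x a0 s) s1.
Proof.
move=> Hl a0 lam0.
pose x' := zeta x a0 s; pose a' := a \o cons s; pose lam' := lam \o cons (s, a0).
pose gam' i := gam i + lam0 i.
pose psi h := base_stage a gam x h + mult_stage a lam x h.
(* The tail of the series still has weight [gam], so it falls short of the continuation Lagrangian
   with weight [gam'] by the [lam0]-weighted continuation values. *)
have step s1 : dcvg pi beta (psi \o cons s) s1
    (L a' lam' gam' x' s1 + \sum_i (- lam0 i) * cont i a' x' [:: s1]).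
  have cL := @dcvg_Lag a' lam' gam' x' s1 (Lam_cons pi_pos beta_gt0 a0 s1 Hl).
  have cg i := @dcvg_evalh _ _ _ _ _ _ pi_pos pi_sum beta_gt0 beta_lt1 zeta _ _ (g_bdd i) a' x' s1.
  apply: eq_dcvg (dcvgD cL (@dcvg_sum _ _ _ _ pi_sum beta_gt0 beta_lt1 _ (fun i => - lam0 i) _ _ _ cg)) => w.
  rewrite [RHS]/comp /psi /base_stage /mult_stage !evalh_cons.
  rewrite addrAC; congr (_ + _); last first.
    by apply: eq_bigr => i _; rewrite contval_cons (posth_cons a).
  rewrite -addrA; congr (_ + _).
  under [RHS]eq_bigr do rewrite evalh_cons -/a0 -/a' -/x'.
  rewrite -big_split; apply: eq_bigr => i _.
  by apply: etrans (esym (mulrDl _ _ _)) _; rewrite /gam' addrK.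
have -> : L a lam gam x s = psi [:: s] + beta * \sum_s1 pi s s1 *
    (L a' lam' gam' x' s1 + \sum_i (- lam0 i) * cont i a' x' [:: s1]).
  by rewrite LagE; apply: dcvg_lim; exact: (dcvg_rec step).
have cE i : cont i a x [:: s] = g i x a0 s +
    beta * \sum_s1 pi s s1 * cont i a' x' [:: s1].
  exact: (contval_rec pi_pos pi_sum beta_gt0 beta_lt1 zeta (g_bdd i)).
(* Unrolling the date-0 values of [g] once leaves the [lam0]-weighted continuation values as an
   extra term. *)
have -> : psi [:: s] = r x a0 s + \sum_i (gam i * g i x a0 s + lam0 i * (g i x a0 s - gbar i))
    + beta * \sum_s1 pi s s1 * \sum_i lam0 i * cont i a' x' [:: s1].
  rewrite /psi /base_stage /mult_stage -!addrA; congr (_ + _).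
  rewrite big_split /= -addrA; congr (_ + _).
  under eq_bigr do rewrite cE.
  rewrite posth_cons -/a0 -/lam0.
  under [X in _ = _ + _ * X]eq_bigr do rewrite big_distrr /=.
  rewrite exchange_big /= big_distrr -big_split /=; apply: eq_bigr => i _.
  rewrite addrAC mulrDr; congr (_ + _).
  rewrite mulrCA; congr (_ * _); rewrite big_distrr /=.
  by apply: eq_bigr => s1 _; rewrite mulrCA.
rewrite -[LHS]addrA; congr (_ + _); rewrite -mulrDr -big_split /=; congr (_ * _).
apply: eq_bigr => s1 _; rewrite -mulrDr; congr (_ * _).
(* The extra term cancels the shortfall from [step]. *)
rewrite addrCA -big_split /= big1 ?addr0 // => i _.
by rewrite mulNr subrr.
Qed.

Lemma eq_Lag a b (lam mu : multiplier) gam x s :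
  (forall w, a (s :: w) = b (s :: w)) ->
  (forall a1 w, lam ((s, a1) :: w) = mu ((s, a1) :: w)) ->
  L a lam gam x s = L b mu gam x s.
Proof.
move=> ea el; congr rseries; apply/funext => t; congr (_ * _).
apply: eq_bigr => w _; congr (_ * _).
rewrite (eq_posth _ ea) (eq_evalh zeta r x _ ea).
congr (_ + _ + _); first by apply: eq_bigr => i _; rewrite (eq_evalh _ _ _ _ ea).
by apply: eq_bigr => i _; rewrite (eq_contval _ _ _ _ _ _ ea) posth_cons el.
Qed.

Definition Lbound (gam : 'I_nI -> R) : R :=
  (Mr + \sum_i `|gam i| * Mg i) / (1 - beta).

Lemma base_stage_bound a gam x s w :
  `|base_stage a gam x (s :: w)| <= Mr + \sum_i `|gam i| * Mg i.
Proof.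
apply: le_trans (ler_normD _ _) _; apply: lerD; first exact: r_bdd.
apply: le_trans (ler_norm_sum _ _ _) _; apply: ler_sum => i _.
by rewrite normrM ler_wpM2l //; exact: g_bdd.
Qed.

Lemma Lag0_le a gam x s : L a (fun=> fun=> 0) gam x s <= Lbound gam.
Proof.
apply: (ler_dcvg pi_pos beta_gt0 _ (@dcvg_Lag a _ gam x s (Lam0 A nI pi_pos beta_gt0 s))
  (@dcvg_cst _ _ _ _ pi_sum beta_gt0 beta_lt1 _ _)) => w.
rewrite /mult_stage big1 ?addr0; last by move=> i _; rewrite mul0r.
exact: le_trans (ler_norm _) (base_stage_bound _ _ _ _ _).
Qed.

(** Feasibility makes every multiplier term nonnegative, so dropping them gives a bound uniform in
    [lam]. *)
Lemma feasible_Lag_ge a lam gam x s : Lam pi beta s lam ->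
  feasible pi beta zeta p g gbar x s a -> - Lbound gam <= L a lam gam x s.
Proof.
move=> Hl [_ Hf]; rewrite /Lbound -mulNr.
apply: (ler_dcvg pi_pos beta_gt0 _ (@dcvg_cst _ _ _ _ pi_sum beta_gt0 beta_lt1 _ _)
  (@dcvg_Lag a lam gam x s Hl)) => w.
rewrite ler_wpDr //.
  apply: sumr_ge0 => i _; rewrite mulr_ge0 ?subr_ge0 //.
  by have [l0 _] := Hl; exact: l0.
by have := base_stage_bound a gam x s w; rewrite ler_norml => /andP[].
Qed.

End Lagrangian.

(** * The dual value and its recursion *)

Section DualValue.
Variables (R : realType) (S A : finType) (X : Type) (nI : nat).
Variables (pi : S -> S -> R) (beta : R) (zeta : X -> A -> S -> X).
Variables (p r : X -> A -> S -> R) (g : 'I_nI -> X -> A -> S -> R).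
Variables (gbar : 'I_nI -> R) (Mr : R) (Mg : 'I_nI -> R).
Hypothesis pi_pos : forall s s', 0 < pi s s'.
Hypothesis pi_sum : forall s, \sum_(s' : S) pi s s' = 1.
Hypothesis beta_gt0 : 0 < beta.
Hypothesis beta_lt1 : beta < 1.
Hypothesis r_bdd : forall x a s, `|r x a s| <= Mr.
Hypothesis g_bdd : forall i x a s, `|g i x a s| <= Mg i.
Hypothesis feas : forall (x0 : X) (s0 : S),
  exists a, feasible pi beta zeta p g gbar x0 s0 a.

Notation multiplier := (seq (S * A) -> 'I_nI -> R).
Notation L a lam gam x s := (Lag pi beta zeta r g gbar a lam gam x s).
Notation D gam x s := (Dtil pi beta zeta p r g gbar gam x s).

Lemma Dtil_fin_num gam x s : D gam x s \is a fin_num.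
Proof.
rewrite fin_numElt; apply/andP; split.
  apply: (@lt_le_trans _ _ (- Lbound beta Mr Mg gam)%:E); first exact: ltNyr.
  apply: le_ereal_inf_tmp => _ [lam Hl <-].
  have [a Ha] := feas x s; apply: le_trans (ereal_sup_ubound _); last first.
    by exists a; [case: Ha|reflexivity].
  by rewrite lee_fin; exact: (feasible_Lag_ge pi_pos pi_sum beta_gt0 beta_lt1 r_bdd g_bdd _ Hl Ha).
apply: (@le_lt_trans _ _ (Lbound beta Mr Mg gam)%:E); last exact: ltry.
apply: le_trans (ereal_inf_lbound _) _.
  by exists (fun=> fun=> 0); [exact: (Lam0 A nI pi_pos beta_gt0 s)|reflexivity].
apply: ge_ereal_sup => _ [a Ha <-]; rewrite lee_fin.
exact: (Lag0_le zeta gbar pi_pos pi_sum beta_gt0 beta_lt1 r_bdd g_bdd).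
Qed.

(** The bracket of the recursion as a real number; [fine] loses nothing because dual values are
    finite. *)
Definition bellman (gam : 'I_nI -> R) x s (a0 : A) (lam0 : 'I_nI -> R) : R :=
  r x a0 s + \sum_(i < nI) (gam i * g i x a0 s + lam0 i * (g i x a0 s - gbar i)) +
  beta * \sum_s1 pi s s1 * fine (D (fun i => gam i + lam0 i) (zeta x a0 s) s1).

Lemma bellmanE gam x s a0 lam0 : (bellman gam x s a0 lam0)%:E =
  ((r x a0 s + \sum_(i < nI) (gam i * g i x a0 s + lam0 i * (g i x a0 s - gbar i)))%:E
   + beta%:E * \sum_(s1 : S) (pi s s1)%:E *
       D (fun i => (gam i + lam0 i)%R) (zeta x a0 s) s1)%E.
Proof.
rewrite /bellman EFinD [in LHS]EFinM -sumEFin; congr (_ + _ * _)%E.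
by apply: eq_bigr => s1 _; rewrite EFinM fineK // Dtil_fin_num.
Qed.

Lemma sum_pi_shift (s : S) (u : S -> R) e :
  \sum_s1 pi s s1 * (u s1 + e) = \sum_s1 pi s s1 * u s1 + e.
Proof.
under eq_bigr do rewrite mulrDr.
by rewrite big_split /= -mulr_suml pi_sum mul1r.
Qed.

(** For each [s1] the dual value is at most the supremum over plans against the continuation of
    [lam]; plans that miss the dual value by less than [e] are glued behind [a0]. *)
Lemma Lag_glue_plan_ge gam x s a0 (lam : multiplier) e :
  Lam pi beta s lam -> Atil p x s a0 -> 0 < e ->
  exists2 a, Ainf zeta p x a &
    bellman gam x s a0 (lam [:: (s, a0)]) - e <= L a lam gam x s.
Proof.
move=> Hl Ha0 e0.
pose gam' i := gam i + lam [:: (s, a0)] i; pose x' := zeta x a0 s.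
have /choice[b Hb] s1 : exists b, Ainf zeta p x' b /\
    fine (D gam' x' s1) - e < L b (lam \o cons (s, a0)) gam' x' s1.
  have Hl1 := Lam_cons pi_pos beta_gt0 a0 s1 Hl.
  have : ((fine (D gam' x' s1) - e)%:E < D gam' x' s1)%E.
    by rewrite -[ltRHS]fineK ?Dtil_fin_num // lte_fin gtrBl.
  move=> /lt_le_trans/(_ (ereal_inf_lbound _)) => /(_ _ (ex_intro2 _ _ _ Hl1 erefl)).
  by move=> /ereal_sup_gt[_ [b Hb <-]]; rewrite lte_fin => ?; exists b.
have [d [Hd _]] := feas x s.
exists (glue_plan a0 s b d); first by apply: Ainf_glue => // s1; case: (Hb s1).
rewrite (Lag_rec zeta gbar pi_pos pi_sum beta_gt0 beta_lt1 r_bdd g_bdd _ _ _ Hl) glue_plan1.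
rewrite /bellman -/gam' -/x' -addrA lerD2l.
(* Each continuation loses less than [e], so the total loss is at most $\beta e\le e$. *)
apply: (@le_trans _ _ (beta * \sum_s1 pi s s1 * (fine (D gam' x' s1) - e))).
  rewrite sum_pi_shift mulrDr lerD2l mulrN lerN2.
  by rewrite -[leRHS]mul1r ler_wpM2r ?ltW.
rewrite ler_wpM2l ?(ltW beta_gt0) //; apply: ler_sum => s1 _.
rewrite ler_wpM2l ?(ltW (pi_pos _ _)) //.
rewrite (@eq_Lag _ _ _ _ _ _ _ _ _ _ _ _ (b s1) _ (lam \o cons (s, a0))) //.
  by case: (Hb s1) => _ /ltW.
by move=> w; rewrite /= glue_planE.
Qed.

(** Each admissible [a0] gets its own [lam0] and, for each [s1], its own near-minimal continuation
    multiplier; glued together they work against all plans at once. The strict inequality leaves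
    room for the approximation. *)
Lemma Lag_glue_multiplier_le gam x s c :
  (forall a0, Atil p x s a0 -> exists2 lam0, (forall i, 0 <= lam0 i) &
     bellman gam x s a0 lam0 < c) ->
  exists2 lam, Lam pi beta s lam &
    forall a, Ainf zeta p x a -> L a lam gam x s <= c.
Proof.
move=> H.
have /choice[lam0 H0] a0 : exists lam0 : 'I_nI -> R, (forall i, 0 <= lam0 i) /\
    (Atil p x s a0 -> bellman gam x s a0 lam0 < c).
  have [/H[l0 ? ?]|nA] := pselect (Atil p x s a0); first by exists l0.
  by exists (fun=> 0).
pose gam' a0 i := gam i + lam0 a0 i.
(* The slack below [c], positive for admissible [a0]; spending it on every continuation costs only
   [beta * e a0]. *)
pose e a0 := c - bellman gam x s a0 (lam0 a0).
have /choice[mu Hmu] (q : A * S) : exists mu : multiplier, Lam pi beta q.2 mu /\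
    (Atil p x s q.1 -> forall b, Ainf zeta p (zeta x q.1 s) b ->
       L b mu (gam' q.1) (zeta x q.1 s) q.2 <=
       fine (D (gam' q.1) (zeta x q.1 s) q.2) + e q.1).
  case: q => a0 s1 /=.
  have [HA|nA] := pselect (Atil p x s a0); last first.
    by exists (fun=> fun=> 0); split => //; exact: (Lam0 A nI pi_pos beta_gt0 s1).
  have e0 : 0 < e a0 by rewrite subr_gt0; exact: (H0 a0).2.
  have : (D (gam' a0) (zeta x a0 s) s1 <
      (fine (D (gam' a0) (zeta x a0 s) s1) + e a0)%:E)%E.
    by rewrite -[ltLHS]fineK ?Dtil_fin_num // lte_fin ltrDl.
  move=> /ereal_inf_lt[_ [mu Hmu <-] /ltW Hsup]; exists mu; split => // _ b Hb.
  rewrite -lee_fin; apply: le_trans Hsup; apply: ereal_sup_ubound.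
  by exists b.
pose lam := glue_multiplier lam0 (fun a0 s1 => mu (a0, s1)).
have Hl : Lam pi beta s lam.
  apply: (Lam_glue pi_pos beta_gt0) => [a0|a0 s1]; first exact: (H0 a0).1.
  exact: (Hmu (a0, s1)).1.
exists lam => // a Ha; have HA := Ainf_head s Ha; set a0 := a [:: s] in HA.
rewrite (Lag_rec zeta gbar pi_pos pi_sum beta_gt0 beta_lt1 r_bdd g_bdd _ _ _ Hl) -/a0 /=.
apply: (@le_trans _ _ (bellman gam x s a0 (lam0 a0) + beta * e a0)); last first.
  rewrite -[leRHS](subrK (bellman gam x s a0 (lam0 a0))) addrC lerD2r.
  rewrite -[leRHS]mul1r ler_wpM2r ?(ltW beta_lt1) // subr_ge0 ltW //.
  exact: (H0 a0).2.
rewrite /bellman -[leRHS]addrA lerD2l -mulrDr -(sum_pi_shift s).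
rewrite ler_wpM2l ?(ltW beta_gt0) //; apply: ler_sum => s1 _.
rewrite ler_wpM2l ?(ltW (pi_pos _ _)) //.
rewrite (@eq_Lag _ _ _ _ _ _ _ _ _ _ _ _ (a \o cons s) _ (mu (a0, s1))) //.
by apply: (Hmu (a0, s1)).2 => //; exact: Ainf_cons.
Qed.

Lemma Dtil_bellman gam x s : D gam x s =
  ereal_sup [set
    ereal_inf [set (bellman gam x s a0 lam0)%:E
      | lam0 in [set lam0 : 'I_nI -> R | forall i, 0 <= lam0 i]]
    | a0 in Atil p x s].
Proof.
apply/eqP; rewrite eq_le; apply/andP; split; last first.
  (* The dual value is bounded below: the date-0 value of any [lam] is a candidate in the inner
     infimum. *)
  apply: ge_ereal_sup => _ [a0 Ha0 <-]; apply: le_ereal_inf_tmp => _ [lam Hl <-].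
  apply: (@le_trans _ _ (bellman gam x s a0 (lam [:: (s, a0)]))%:E).
    apply: ereal_inf_lbound; exists (lam [:: (s, a0)]) => // i.
    by have [l0 _] := Hl; exact: l0.
  apply/lee_addgt0Pr => e e0.
  have [a Ha] := Lag_glue_plan_ge gam Hl Ha0 e0.
  rewrite lerBlDr -lee_fin => /le_trans; apply; rewrite [leLHS]EFinD leeD2r //.
  by apply: ereal_sup_ubound; exists a.
set V := ereal_sup _.
(* The upper bound on the dual value is tested against reals [c] above [V], which gives the strict
   inequality needed to pick near-minimal multipliers. *)
suff H c : (V < c%:E)%E -> (D gam x s <= c%:E)%E.
  case: V H => [v| |] H; last 2 first.
  - by rewrite leey.
  (* [V] cannot be $-\infty$: with [c] one below the finite dual value, [H] would be
     contradictory. *)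
  - rewrite leNgt; apply/negP => _; have := H (fine (D gam x s) - 1) (ltNyr _).
    by rewrite -[leLHS]fineK ?Dtil_fin_num // lee_fin lerBrDr gerDl ler10.
  apply/lee_addgt0Pr => e e0; rewrite -EFinD; apply: H.
  by rewrite lte_fin ltrDl.
move=> Vc; have [|lam Hl Hle] := @Lag_glue_multiplier_le gam x s c.
  move=> a0 Ha0.
  have : (ereal_inf [set (bellman gam x s a0 lam0)%:E
      | lam0 in [set lam0 : 'I_nI -> R | forall i, (0 <= lam0 i)%R]] < c%:E)%E.
    by apply: le_lt_trans Vc; apply: ereal_sup_ubound; exists a0.
  move=> /ereal_inf_lt[_ [lam0 H0 <-]]; rewrite lte_fin => ?.
  by exists lam0.
apply: le_trans (ereal_inf_lbound _) _; first by exists lam; [exact: Hl|reflexivity].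
by apply: ge_ereal_sup => _ [a Ha <-]; rewrite lee_fin; exact: Hle.
Qed.

End DualValue.

(** * The recursion in extended-real form *)

Unset Implicit Arguments.

Theorem theorem3p3 (R : realType) (S : finType) (X : countType) (A : finType)
    (nI : nat) (pi : S -> S -> R) (beta : R)
    (zeta : X -> A -> S -> X) (p r : X -> A -> S -> R)
    (g : 'I_nI -> X -> A -> S -> R) (gbar : 'I_nI -> R)
    (pi_pos : forall s s', 0 < pi s s')
    (pi_sum : forall s, \sum_(s' : S) pi s s' = 1)
    (beta_gt0 : 0 < beta) (beta_lt1 : beta < 1)
    (r_bdd : exists M : R, forall x a s, `|r x a s| <= M)
    (g_bdd : forall i, exists M : R, forall x a s, `|g i x a s| <= M)
    (feas : forall (x0 : X) (s0 : S),
        exists a, feasible pi beta zeta p g gbar x0 s0 a)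
    (x : X) (s : S) (gam : 'I_nI -> R) (gam_ge0 : forall i, 0 <= gam i) :
  Dtil pi beta zeta p r g gbar gam x s =
  ereal_sup [set
    ereal_inf [set
      ((r x a s + \sum_(i < nI) (gam i * g i x a s + lam i * (g i x a s - gbar i)))%:E
       + beta%:E * \sum_(s' : S) (pi s s')%:E *
           Dtil pi beta zeta p r g gbar (fun i => (gam i + lam i)%R) (zeta x a s) s')%E
      | lam in [set lam : 'I_nI -> R | forall i, 0 <= lam i]]
    | a in Atil p x s].
Proof.
have [Mr Hr] := r_bdd; have [Mg Hg] := choice g_bdd.
rewrite (Dtil_bellman pi_pos pi_sum beta_gt0 beta_lt1 Hr Hg feas).
congr ereal_sup; apply: eq_imagel => a _; congr ereal_inf.
apply: eq_imagel => lam _.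
by rewrite (bellmanE pi_pos pi_sum beta_gt0 beta_lt1 Hr Hg feas).
Qed.
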